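(* Fix an integer $n>1$. Then the Dirichlet series $\zeta^R_{\mathbb{Z}^n}(s)$ diverges for all $s\in\mathbb{C}$ such that $$\operatorname{Re}(s) \leq \max_{0 \leq d \leq n-1} \left(\frac{d(n-1-d)}{n-1+d} + \frac{1}{n-1+d}\right),$$ where the maximum is over all integers $d$ with $0\le d\le n-1$.
   Context: A subring of $\mathbb{Z}^n$ is a sublattice (additive subgroup) of $\mathbb{Z}^n$ that contains the multiplicative identity $(1,1,\ldots,1)$ and is closed under componentwise multiplication. For a positive integer $k$, $f_n(k)$ denotes the number of subrings of $\mathbb{Z}^n$ of finite index $k$. The subring zeta function of $\mathbb{Z}^n$ is the Dirichlet series $\zeta^R_{\mathbb{Z}^n}(s) = \sum_{k=1}^\infty f_n(k)k^{-s}$. *)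

(* Defs.v *)
From mathcomp Require Import all_boot all_order all_algebra.
From mathcomp Require Import finmap.
From mathcomp Require Import all_classical all_reals all_analysis.
From mathcomp Require Import complex.
Set Implicit Arguments.
Unset Strict Implicit.
Unset Printing Implicit Defensive.
Import Order.TTheory GRing.Theory Num.Theory.
Import numFieldNormedType.Exports.
Local Open Scope classical_set_scope.
Local Open Scope ring_scope.
Local Open Scope complex_scope.

(* The ring Z^n is {ffun 'I_n -> int}, whose library ring structure is the
   componentwise one, with unit the constant function 1. *)
Definition is_subring (n : nat) (L : set {ffun 'I_n -> int}) : Prop :=
  subring_closed (mem L).

Definition cosets (V : zmodType) (L : set V) : set (set V) :=
  range (fun x : V => [set y | L (y - x)]).

Definition has_index (V : zmodType) (L : set V) (k : nat) : Prop :=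
  (cosets L #= `I_k)%card.

Definition subrings_of_index (n k : nat) : set (set {ffun 'I_n -> int}) :=
  [set L | is_subring L /\ has_index L k].
Arguments subrings_of_index : clear implicits.

(* [fset_set] sends an infinite set to the empty one. That case does not arise
   for k > 0: a subgroup of index k contains k Z^n, hence is determined by its
   image in the finite group (Z/k)^n. *)
Definition nb_subrings (n k : nat) : nat :=
  #|` fset_set (subrings_of_index n k)|%fset.

(* k ^ (- s) = exp (- s ln k)
             = exp (- Re s ln k) (cos (Im s ln k) - i sin (Im s ln k)) *)
Definition dirichlet_pow (R : realType) (k : nat) (s : R[i]) : R[i] :=
  let l := ln (k%:R : R) in
  (expR (- (complex.Re s * l)))%:C
  * (cos (complex.Im s * l) -i* sin (complex.Im s * l)).

Definition dirichlet_series (R : realType) (a : nat -> R[i]) (s : R[i])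
    : nat -> R[i] :=
  fun N => \sum_(1 <= k < N.+1) a k * dirichlet_pow k s.

(* The sequence of partial sums. *)
Definition subring_zeta (R : realType) (n : nat) (s : R[i]) : nat -> R[i] :=
  dirichlet_series (fun k => (nb_subrings n k)%:R) s.

(* Main.v *)
(* Let n = N + 1 and 0 <= d <= N. For every r >= 1 the additive groups between
   Z.1 + r^2 Z^n and Z.1 + r Z^n are all subrings, since products of elements of
   r Z^n lie in r^2 Z^n. Those that are graphs of homomorphisms
   (Z/r)^(N - d) -> (Z/r)^d have index r^(N + d), so that
   f_n(r^(N + d)) >= r^(d (N - d)).

   These terms rule out convergence at s, also on the boundary line and off the
   real axis. With m = N + d and q >= m |Im s|, the numbers k^(- i Im s) for
   (q j)^m < k <= ((q + 1) j)^m stay within one radian of each other, so the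
   corresponding block of the series has modulus at least cos 1 times the sum of
   the absolute values, hence at least cos 1 times the sum of 1/r over
   q j < r <= (q + 1) j, that is, at least cos 1 / (q + 1) for every j. *)
Require Import Defs.
From mathcomp Require Import all_boot all_order all_algebra.
From mathcomp Require Import finmap.
From mathcomp Require Import all_classical all_reals all_analysis.
From mathcomp Require Import complex.
From mathcomp Require Import zify ring lra.
Set Implicit Arguments.
Unset Strict Implicit.
Unset Printing Implicit Defensive.
Import Order.TTheory GRing.Theory Num.Theory.
Import numFieldNormedType.Exports.
Local Open Scope classical_set_scope.
Local Open Scope ring_scope.

(** * Finiteness of the set of subrings of a given index *)

Lemma ltn_abs_modz (m : nat) (z : int) : (0 < m)%N -> (`|(z %% m)%Z| < m)%N.
Proof.
by move=> m_gt0; rewrite -ltz_nat gez0_abs ?modz_ge0 ?ltz_pmod //; lia.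
Qed.

Lemma zmod_closed_mulrn (V : zmodType) (L : set V) (x : V) (m : nat) :
  GRing.zmod_closed (mem L) -> L x -> L (x *+ m).
Proof.
move=> hL Lx; have [L0 LD] := GRing.zmod_closedD hL.
elim: m => [|m IHm]; first by move: L0; rewrite inE mulr0n.
by rewrite mulrS; move: (LD x (x *+ m)); rewrite !inE; apply.
Qed.

(** Pigeonhole: two of the k + 1 multiples [x *+ i] with i <= k define the same coset, so [L]
    contains some [x *+ (j - i)] with 0 < j - i <= k, and j - i divides k!. *)
Lemma has_index_fact_mem (V : zmodType) (L : set V) (k : nat) (x : V) :
  GRing.zmod_closed (mem L) -> has_index L k -> L (x *+ k`!).
Proof.
move=> hL hk; have [L0 _] := hL.
pose c (i : 'I_k.+1) : set V := [set y | L (y - x *+ i)].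
have finL : finite_set (cosets L) by apply/finite_setP; exists k.
have /injectivePn[i [j ij cij]] : ~~ injectiveb c.
  apply/negP => /injectiveP cI.
  have := @uniq_leq_size _ [seq c i | i : 'I_k.+1] (fset_set (cosets L)).
  rewrite size_map size_enum_ord (card_fset_set hk) ltnn.
  rewrite map_inj_uniq ?enum_uniq // => /(_ isT) cN.
  suff : false by [].
  apply: cN => _ /mapP[i _ ->].
  by rewrite in_fset_set // inE; exists (x *+ i).
wlog lt_ij : i j ij cij / (i < j)%N.
  move=> H; have [ltij|leji] := ltnP i j; first exact: (H i j).
  by apply: (H j i); rewrite 1?eq_sym // ltn_neqAle eq_sym ij.
have Lji : L (x *+ (j - i)).
  rewrite mulrnBr 1?ltnW //; suff : c i (x *+ j) by [].
  by rewrite cij /c /= subrr; move: L0; rewrite inE.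
have /dvdnP[q ->] : (j - i %| k`!)%N.
  by rewrite dvdn_fact // subn_gt0 lt_ij leq_subLR; have := ltn_ord j; lia.
by rewrite mulnC mulrnA; apply: zmod_closed_mulrn.
Qed.

(** By [has_index_fact_mem] such a subring contains k! Z^n, so it is determined by its vectors with
    entries in [0, k!), a subset of a finite set. *)
Lemma finite_subrings_of_index (n k : nat) : finite_set (subrings_of_index n k).
Proof.
pose f (L : set {ffun 'I_n -> int}) : {set {ffun 'I_n -> 'I_(k`!)}} :=
  finset (fun u : {ffun 'I_n -> 'I_(k`!)} =>
    `[< L [ffun i => (u i : nat)%:Z] >]).
have finf : finite_set (f @` subrings_of_index n k) by apply: finite_finset.
suff /inj_card_eq/eq_finite_set <- : {in subrings_of_index n k &, injective f}.
  exact: finf.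
move=> L M; rewrite !inE => -[rL iL] [rM iM] fLM.
pose md (x : {ffun 'I_n -> int}) := [ffun i => (x i %% k`!)%Z].
have mem_md (N : set {ffun 'I_n -> int}) x : is_subring N -> has_index N k ->
    N x <-> N (md x).
  move=> rN iN; have zN := GRing.subring_closedB rN.
  have [_ ND] := GRing.zmod_closedD zN; have [_ NB] := zN.
  have := has_index_fact_mem [ffun i => (x i %/ k`!)%Z] zN iN.
  set y := _ *+ _ => Ny.
  have xE : x = md x + y.
    apply/ffunP => i; rewrite !ffunE ffunMnE ffunE addrC -mulr_natr natz.
    exact: divz_eq.
  split=> [Nx|Nmx]; last first.
    by rewrite xE; move: (ND (md x) y); rewrite !inE; apply.
  have -> : md x = x - y by rewrite [in RHS]xE addrK.
  by move: (NB x y); rewrite !inE; apply.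
apply/seteqP; suff H x : L x <-> M x by split=> x; apply H.
rewrite (mem_md L) // (mem_md M) //.
pose u := [ffun i => Ordinal (ltn_abs_modz (x i) (fact_gt0 k))].
have -> : md x = [ffun i => (u i : nat)%:Z].
  apply/ffunP => i; rewrite !ffunE /= gez0_abs // modz_ge0 //.
  by have := fact_gt0 k; lia.
have := congr1 (fun S : {set _} => u \in S) fLM; rewrite !inE => H.
by split => /asboolP; [rewrite H|rewrite -H] => /asboolP.
Qed.

(** * Computing an index by means of residues *)

Lemma has_index_card (V : zmodType) (T : finType) (L : set V) (phi : V -> T) :
  (forall t, exists x, phi x = t) ->
  (forall x y, phi x = phi y <-> L (x - y)) -> has_index L #|T|.
Proof.
move=> phi_surj phi_ker.
(* The cosets of [L] are exactly the fibres of [phi]. *)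
pose F (t : T) : set V := [set x | phi x = t].
rewrite /has_index; have -> : cosets L = range F.
  apply/seteqP; split=> [_ [x _ <-]|_ [t _ <-]].
    by exists (phi x) => //; apply/seteqP; split=> y; rewrite /F /= phi_ker.
  have [x <-] := phi_surj t.
  by exists x => //; apply/seteqP; split=> y; rewrite /F /= phi_ker.
apply: (@card_eq_trans _ _ _ _ [set: T]).
  apply: inj_card_eq => s t _ _ /seteqP[st _].
  have [x xs] := phi_surj s.
  by rewrite -xs; apply: (st x).
rewrite (_ : [set: T] = [set` [fset x in {: T}]%fset]).
  by apply/card_eq_fsetP; rewrite card_finset.
by apply/seteqP; split=> x //= _; rewrite !inE.
Qed.

Definition residue_ord (m : nat) (m_gt0 : (0 < m)%N) (z : int) : 'I_m :=
  Ordinal (ltn_abs_modz z m_gt0).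

Lemma residue_ord_eq m (m_gt0 : (0 < m)%N) z w :
  residue_ord m_gt0 z = residue_ord m_gt0 w <-> (m %| z - w)%Z.
Proof.
have m_neq0 : m%:Z != 0 by lia.
rewrite -eqz_mod_dvd; split=> [[/(congr1 Posz)]|/eqP zw].
  by rewrite !gez0_abs ?modz_ge0 // => ->.
by apply: val_inj; rewrite /= zw.
Qed.

Lemma residue_ordK m (m_gt0 : (0 < m)%N) (i : 'I_m) :
  residue_ord m_gt0 i = i.
Proof. by apply: val_inj; rewrite /= modz_small //= ltz_nat. Qed.

(** * Subrings attached to graphs of homomorphisms *)

Definition diff0 n (x : {ffun 'I_n.+1 -> int}) (k : 'I_n) : int :=
  x (lift ord0 k) - x ord0.

(* For a homomorphism (Z/r)^a -> (Z/r)^d with matrix [A]: a vector of Z^(1+a+d)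
   whose differences [diff0] are [r y] lies in the corresponding subring iff the
   last d entries of y are the image of the first a entries modulo r. *)
Definition graph_form (r a d : nat) (A : {ffun 'I_d * 'I_a -> 'I_r})
    (x : {ffun 'I_(a + d).+1 -> int}) (i : 'I_d) : int :=
  diff0 x (rshift a i) - \sum_j (A (i, j) : nat)%:Z * diff0 x (lshift d j).

Definition graph_subring (r a d : nat) (A : {ffun 'I_d * 'I_a -> 'I_r}) :
    set {ffun 'I_(a + d).+1 -> int} :=
  [set x | (forall j, (r %| diff0 x (lshift d j))%Z) /\
           (forall i, ((r ^ 2)%N %| graph_form A x i)%Z)].

Lemma diff0B n (x y : {ffun 'I_n.+1 -> int}) k :
  diff0 (x - y) k = diff0 x k - diff0 y k.
Proof. by rewrite /diff0 !ffunE; ring. Qed.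

Lemma diff0M n (x y : {ffun 'I_n.+1 -> int}) k :
  diff0 (x * y) k
  = diff0 x k * diff0 y k + x ord0 * diff0 y k + y ord0 * diff0 x k.
Proof. by rewrite /diff0 !ffunE; ring. Qed.

Lemma graph_formB r a d (A : {ffun 'I_d * 'I_a -> 'I_r}) x y i :
  graph_form A (x - y) i = graph_form A x i - graph_form A y i.
Proof.
rewrite /graph_form diff0B; under eq_bigr do rewrite diff0B mulrBr.
by rewrite sumrB; ring.
Qed.

(** For the last d differences, r divides both [graph_form], which is even a multiple of r^2, and
    the combination of the first a differences. *)
Lemma graph_subring_diff0 r a d (A : {ffun 'I_d * 'I_a -> 'I_r}) x k :
  graph_subring A x -> (r %| diff0 x k)%Z.
Proof.
move=> [xl xr]; rewrite -(splitK k); case: (fintype.split k) => [//|i] /=.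
have -> : diff0 x (rshift a i) = graph_form A x i
    + \sum_j (A (i, j) : nat)%:Z * diff0 x (lshift d j) by rewrite subrK.
rewrite rpredD ?rpred_sum // => [|j _]; last by rewrite dvdz_mull.
by apply: dvdz_trans (xr i); rewrite PoszM dvdz_mulr.
Qed.

(* Modulo [r^2] the product term of [diff0M] vanishes on [graph_subring A],
   so [graph_form A] behaves like a derivation there. *)
Lemma graph_subring_subring r a d (A : {ffun 'I_d * 'I_a -> 'I_r}) :
  is_subring (graph_subring A).
Proof.
split=> [|x y|x y]; rewrite !inE.
- have d1 k : diff0 (1 : {ffun 'I_(a + d).+1 -> int}) k = 0.
    by rewrite /diff0 !ffunE subrr.
  split=> [j|i]; first by rewrite d1.
  by rewrite /graph_form d1 big1 ?subr0 // => j _; rewrite d1 mulr0.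
- move=> [xl xr] [yl yr]; split=> [j|i]; rewrite ?diff0B ?graph_formB rpredB //.
- move=> Gx Gy; have [_ xr] := Gx; have [_ yr] := Gy.
  have xd k := graph_subring_diff0 k Gx; have yd k := graph_subring_diff0 k Gy.
  split=> [j|i]; first by rewrite diff0M !rpredD // ?dvdz_mull.
  have -> : graph_form A (x * y) i = x ord0 * graph_form A y i
      + y ord0 * graph_form A x i + (diff0 x (rshift a i) * diff0 y (rshift a i)
      - \sum_j (A (i, j) : nat)%:Z
          * (diff0 x (lshift d j) * diff0 y (lshift d j))).
    rewrite /graph_form diff0M !mulrBr !mulr_sumr.
    have -> : \sum_j (A (i, j) : nat)%:Z * diff0 (x * y) (lshift d j)
        = \sum_j x ord0 * ((A (i, j) : nat)%:Z * diff0 y (lshift d j))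
        + \sum_j y ord0 * ((A (i, j) : nat)%:Z * diff0 x (lshift d j))
        + \sum_j (A (i, j) : nat)%:Z
            * (diff0 x (lshift d j) * diff0 y (lshift d j)).
      by rewrite -!big_split /=; apply: eq_bigr => j _; rewrite diff0M; ring.
    ring.
  have dvd_xy k l : ((r ^ 2)%N %| diff0 x k * diff0 y l)%Z.
    by rewrite PoszM dvdz_mul.
  rewrite rpredD // ?rpredB // ?dvdz_mull //.
    by rewrite rpredD // dvdz_mull.
  by rewrite rpred_sum // => j _; rewrite dvdz_mull.
Qed.

(** The vector with prescribed differences and initial coordinate 0; it supplies the witnesses for
    the index and for injectivity. *)
Definition graph_point (a d : nat) (u : 'I_a -> int) (v : 'I_d -> int) :
    {ffun 'I_(a + d).+1 -> int} :=
  [ffun k => if unlift ord0 k is Some l then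
               match fintype.split l with inl j => u j | inr i => v i end
             else 0].

Lemma diff0_graph_point_l a d (u : 'I_a -> int) (v : 'I_d -> int) j :
  diff0 (graph_point u v) (lshift d j) = u j.
Proof. by rewrite /diff0 !ffunE liftK unlift_none (unsplitK (inl j)) subr0. Qed.

Lemma diff0_graph_point_r a d (u : 'I_a -> int) (v : 'I_d -> int) i :
  diff0 (graph_point u v) (rshift a i) = v i.
Proof. by rewrite /diff0 !ffunE liftK unlift_none (unsplitK (inr i)) subr0. Qed.

Lemma graph_form_point r a d (A : {ffun 'I_d * 'I_a -> 'I_r}) u v i :
  graph_form A (graph_point u v) i = v i - \sum_j (A (i, j) : nat)%:Z * u j.
Proof.
rewrite /graph_form diff0_graph_point_r.
by under eq_bigr do rewrite diff0_graph_point_l.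
Qed.

Lemma graph_subring_index r a d (A : {ffun 'I_d * 'I_a -> 'I_r}) :
  (0 < r)%N -> has_index (graph_subring A) (r ^ (a + d.*2)).
Proof.
move=> r_gt0; have r2_gt0 : (0 < r ^ 2)%N by rewrite expn_gt0 r_gt0.
pose phi x : {ffun 'I_a -> 'I_r} * {ffun 'I_d -> 'I_(r ^ 2)} :=
  ([ffun j => residue_ord r_gt0 (diff0 x (lshift d j))],
   [ffun i => residue_ord r2_gt0 (graph_form A x i)]).
have -> : (r ^ (a + d.*2))%N
    = #|{: {ffun 'I_a -> 'I_r} * {ffun 'I_d -> 'I_(r ^ 2)}}|.
  by rewrite card_prod !card_ffun !card_ord expnD -expnM mul2n.
apply: (has_index_card (phi := phi)) => [[u v]|x y].
  (* The added sum cancels the one in [graph_form], so both families of residues can be prescribed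
     independently. *)
  exists (graph_point (fun j => (u j : nat)%:Z)
    (fun i => (v i : nat)%:Z + \sum_j (A (i, j) : nat)%:Z * (u j : nat)%:Z)).
  congr (_, _); apply/ffunP => k; rewrite ffunE.
    by rewrite diff0_graph_point_l residue_ordK.
  by rewrite graph_form_point addrK residue_ordK.
split=> [[/ffunP xl /ffunP xr]|[xl xr]].
  split=> k.
    rewrite diff0B; apply/(residue_ord_eq r_gt0).
    by have := xl k; rewrite !ffunE.
  rewrite graph_formB; apply/(residue_ord_eq r2_gt0).
  by have := xr k; rewrite !ffunE.
congr (_, _); apply/ffunP => k; rewrite !ffunE; apply/residue_ord_eq.
  by rewrite -diff0B.
by rewrite -graph_formB.
Qed.

Lemma graph_subring_inj r a d :
  injective (@graph_subring r a d).
Proof.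
move=> A B eqAB; apply/ffunP => -[i j]; apply: val_inj => /=.
have r_gt0 : (0 < r)%N by have := ltn_ord (A (i, j)); lia.
(* The differences of [x] are r times column j of the graph of [A]. Membership for [B] then gives
   r^2 | r (A_ij - B_ij), and entries in [0, r) congruent modulo r are equal. *)
pose x := graph_point (fun j' => (r * (j' == j))%N%:Z)
  (fun i' => (r * A (i', j))%N%:Z).
have sumE (C : {ffun 'I_d * 'I_a -> 'I_r}) i' :
    \sum_j' (C (i', j') : nat)%:Z * (r * (j' == j))%N%:Z = (r * C (i', j))%N%:Z.
  rewrite (bigD1 j) //= eqxx big1 => [|j' /negPf->]; last first.
    by rewrite muln0 mulr0.
  by rewrite muln1 addr0 mulnC PoszM.
have : graph_subring A x.
  split=> [j'|i']; last by rewrite graph_form_point sumE subrr.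
  by rewrite diff0_graph_point_l PoszM dvdz_mulr.
rewrite eqAB => -[_ /(_ i)]; rewrite graph_form_point sumE.
rewrite !PoszM -mulrBr dvdz_mul2l ?lt0n_neq0 // -eqz_mod_dvd.
by rewrite !modz_small /= ?ltz_nat ?ltn_ord // => /eqP[].
Qed.

Lemma nb_subrings_ge (n d r : nat) : (d <= n)%N -> (0 < r)%N ->
  (r ^ (d * (n - d)) <= nb_subrings n.+1 (r ^ (n + d)))%N.
Proof.
move=> dn r_gt0; have [a ->] : exists a, n = (a + d)%N.
  by exists (n - d)%N; rewrite subnK.
rewrite addnK -addnA addnn.
have := @uniq_leq_size _ [seq graph_subring A | A : {ffun 'I_d * 'I_a -> 'I_r}]
  (fset_set (subrings_of_index (a + d).+1 (r ^ (a + d.*2)))).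
rewrite size_map -cardE card_ffun card_prod !card_ord; apply.
  by rewrite map_inj_uniq ?enum_uniq //; apply: graph_subring_inj.
move=> _ /mapP[A _ ->]; rewrite in_fset_set ?inE; last first.
  exact: finite_subrings_of_index.
by split; [apply: graph_subring_subring | apply: graph_subring_index].
Qed.

(** * Divergence from large coefficients at m-th powers *)

Lemma cos1_le_cos (R : realType) (x : R) : `|x| <= 1 -> cos 1 <= cos x.
Proof.
move=> x1; have -> : cos x = cos `|x|.
  by case: (ger0P x) => // _; rewrite cosN.
have pi2 := pi_ge2 R.
rewrite leNgt ltr_cos -?leNgt // in_itv /= ?normr_ge0; lra.
Qed.

(** Distinct bases have distinct m-th powers, so the left terms occur among the right ones; the
    others are dropped by positivity. *)
Lemma ler_sum_pow (R : numDomainType) (G : nat -> R) (m x y : nat) :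
  (forall k, 0 <= G k) -> (0 < m)%N ->
  \sum_(x <= r < x + y) G (r.+1 ^ m)%N
    <= \sum_(x ^ m <= k < (x + y) ^ m) G k.+1.
Proof.
move=> G0 m0; elim: y => [|y IHy]; first by rewrite addn0 !big_geq.
rewrite addnS big_nat_recr ?leq_addr //=.
have ltm : ((x + y) ^ m < (x + y).+1 ^ m)%N by rewrite ltn_exp2r.
rewrite [leRHS](big_cat_nat _ (n := ((x + y) ^ m)%N)) ?leq_exp2r ?leq_addr //=.
apply: lerD => //; have [z zE] : exists z, ((x + y).+1 ^ m = z.+1)%N.
  by exists ((x + y).+1 ^ m).-1; rewrite prednK ?expn_gt0.
rewrite zE in ltm *; rewrite big_nat_recr //= lerDr sumr_ge0 //.
Qed.

(* The real part of [z * exp (i theta)]. *)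
Definition rotate_Re (R : realType) (theta : R) (z : R[i]) : R :=
  complex.Re z * cos theta - complex.Im z * sin theta.

Lemma rotate_ReD (R : realType) (theta : R) (z w : R[i]) :
  rotate_Re theta (z + w) = rotate_Re theta z + rotate_Re theta w.
Proof. by rewrite /rotate_Re !raddfD /=; ring. Qed.

Lemma rotate_Re_sum (R : realType) (theta : R) (F : nat -> R[i]) a b :
  rotate_Re theta (\sum_(a <= k < b) F k)
  = \sum_(a <= k < b) rotate_Re theta (F k).
Proof.
apply: (big_morph _ (rotate_ReD theta)).
by rewrite /rotate_Re !raddf0 /= !mul0r subrr.
Qed.

Lemma rotate_Re_dirichlet (R : realType) (theta : R) (s : R[i]) (c k : nat) :
  rotate_Re theta (c%:R * dirichlet_pow k s)
  = c%:R * expR (- (complex.Re s * ln k%:R))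
    * cos (complex.Im s * ln k%:R - theta).
Proof.
rewrite cosB /rotate_Re /dirichlet_pow.
have -> : (c%:R : R[i]) = (c%:R)%:C%C by rewrite rmorph_nat.
by rewrite /=; ring.
Qed.

Lemma ler_rotate_Re (R : realType) (theta e : R) (z : R[i]) :
  `|z| < e%:C%C -> rotate_Re theta z <= e *+ 2.
Proof.
move=> ze; have := le_lt_trans (normc_ge_Re z) ze.
have : (`|complex.Im z|%:C < e%:C)%C.
  apply: le_lt_trans ze; rewrite normc_def lecR -sqrtr_sqr ler_wsqrtr //.
  by rewrite lerDr sqr_ge0.
rewrite !ltcR => Im_lt Re_lt; rewrite /rotate_Re mulr2n lerD //.
  rewrite (le_trans (ler_norm _)) // normrM -[e]mulr1.
  by rewrite ler_pM ?cos_max // ltW.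
rewrite (le_trans (ler_norm _)) // normrN normrM -[e]mulr1.
by rewrite ler_pM ?sin_max // ltW.
Qed.

Lemma dirichlet_series_dvg (R : realType) (a : nat -> nat) (m D : nat)
    (s : R[i]) :
  (0 < m)%N -> (forall r, (0 < r)%N -> (r ^ D <= a (r ^ m))%N) ->
  m%:R * complex.Re s <= D%:R + 1 ->
  ~ cvgn (dirichlet_series (fun k => (a k)%:R) s : nat -> R[i]^o).
Proof.
move=> m_gt0 ha hs /cvg_ex[/= l].
set u := dirichlet_series _ s => ul.
set t := complex.Im s.
pose q := (Num.truncn (m%:R * `|t|)).+1.
have qt : m%:R * `|t| <= q%:R by apply/ltW/truncnS_gt.
(* By [ler_rotate_Re], a gap below 2e between partial sums gives the bound 4e = cos 1 / (2 (q + 1)),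
   which is less than the block's lower bound cos 1 / (q + 1). *)
pose e : R := cos 1 / (q.+1%:R *+ 8).
have q_gt0 : 0 < q%:R :> R by rewrite ltr0n.
have e_gt0 : 0 < e by rewrite divr_gt0 ?cos1_gt0 // pmulrn_lgt0 // ltr0n.
have eC_gt0 : 0 < e%:C%C by rewrite ltcR.
have /cvgrPdist_lt/(_ _ eC_gt0)[N _ uN] := ul.
(* This puts both ends of the block at or beyond [N], and keeps them positive. *)
pose j := N.+1.
have ge_pow p : (0 < p)%N -> (N <= (p * j) ^ m)%N.
  move=> p_gt0; apply: (@leq_trans ((p * j) ^ 1)).
    by rewrite expn1 /j; nia.
  by rewrite leq_pexp2l // muln_gt0 p_gt0.
pose X := ((q * j) ^ m)%N; pose Y := ((q.+1 * j) ^ m)%N.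
have leXY : (X <= Y)%N by rewrite leq_exp2r // leq_mul2r leqnSn orbT.
have X_gt0 : (0 < X)%N by rewrite expn_gt0 muln_gt0.
have XY_dist : `|u Y - u X| < (e *+ 2)%:C%C.
  have := uN _ (ge_pow q isT); have := uN _ (ge_pow q.+1 isT).
  rewrite -/X -/Y => uY uX.
  have -> : u Y - u X = (l - u X) - (l - u Y) by ring.
  rewrite mulr2n (rmorphD (real_complex R)).
  exact: le_lt_trans (ler_normB _ _) (ltrD uX uY).
pose theta := t * ln X%:R.
have := ler_rotate_Re theta XY_dist.
have -> : u Y - u X = \sum_(X <= k < Y) (a k.+1)%:R * dirichlet_pow k.+1 s.
  rewrite /u /dirichlet_series (big_cat_nat _ (n := X.+1)) //=.
  by rewrite [LHS]addrC addKr big_add1.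
rewrite rotate_Re_sum; apply/negP; rewrite -ltNge.
pose G k : R := (a k)%:R * expR (- (complex.Re s * ln k%:R)).
have G_ge0 k : 0 <= G k by rewrite mulr_ge0 ?expR_ge0.
(* Since Y / X = (1 + 1/q)^m and ln (1 + x) <= x, the phase moves by at most |t| m / q <= 1 across
   the block. *)
have lnXY : ln Y%:R - ln X%:R <= m%:R / q%:R :> R.
  have qj_gt0 : 0 < (q * j)%:R :> R by rewrite ltr0n muln_gt0.
  have YE : Y%:R = X%:R * (1 + q%:R^-1) ^+ m :> R.
    rewrite /X /Y !natrX -exprMn !natrM -natr1; congr (_ ^+ _).
    by field; rewrite gt_eqF.
  have q1_gt0 : 0 < 1 + q%:R^-1 :> R by rewrite addr_gt0 ?invr_gt0.
  rewrite YE lnM ?posrE ?exprn_gt0 ?ltr0n // lnXn //.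
  rewrite [leLHS]addrC addKr -[_ *+ m]mulr_natl.
  by rewrite ler_wpM2l // le_ln1Dx // (lt_trans (ltrN10 _)) ?invr_gt0.
apply: (@lt_le_trans _ _ (cos 1 * \sum_(X <= k < Y) G k.+1)); last first.
  rewrite mulr_sumr; apply: ler_sum_nat => k /andP[Xk kY].
  rewrite rotate_Re_dirichlet -/(G k.+1) mulrC ler_wpM2l //.
  apply: cos1_le_cos; rewrite /theta -/t -mulrBr normrM.
  have lnXk : ln X%:R <= ln k.+1%:R :> R.
    by rewrite ler_ln ?posrE ?ltr0n ?ler_nat // leqW.
  have lnkY : ln k.+1%:R <= ln Y%:R :> R.
    by rewrite ler_ln ?posrE ?ltr0n ?ler_nat // (leq_trans X_gt0).
  rewrite (ger0_norm (_ : 0 <= ln k.+1%:R - ln X%:R)) ?subr_ge0 //.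
  apply: (@le_trans _ _ (`|t| * (m%:R / q%:R))).
    by rewrite ler_wpM2l //; lra.
  by rewrite mulrA ler_pdivrMr // mul1r mulrC.
apply: (@lt_le_trans _ _ (cos 1 * q.+1%:R^-1)).
  have c_gt0 : 0 < cos 1 / q.+1%:R :> R by rewrite divr_gt0 ?cos1_gt0 ?ltr0n.
  suff -> : e = cos 1 / q.+1%:R / 8.
    move: (cos 1 / _) c_gt0 => c c_gt0; lra.
  by rewrite /e -mulr_natr invfM mulrA.
rewrite ler_wpM2l ?(ltW (cos1_gt0 _)) //.
have YE : Y = ((q * j + j) ^ m)%N by rewrite /Y mulSn addnC.
rewrite {}YE; apply: le_trans (ler_sum_pow _ _ G_ge0 m_gt0).
(* There are j terms, each at least 1 / ((q + 1) j), whatever j is. *)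
apply: (@le_trans _ _ (\sum_(q * j <= r < q * j + j) ((q.+1 * j)%:R)^-1)).
  rewrite sumr_const_nat addKn natrM -mulr_natl -natr1.
  rewrite le_eqVlt; apply/orP; left; apply/eqP; field.
  by rewrite !natr1 !pnatr_eq0.
apply: ler_sum_nat => r /andP[_ rj].
apply: (@le_trans _ _ (r.+1%:R^-1)).
  rewrite lef_pV2 ?posrE ?ltr0n ?muln_gt0 // ler_nat; lia.
have r_gt0 : 0 < r.+1%:R :> R by rewrite ltr0n.
apply: (@le_trans _ _
  (r.+1%:R ^+ D * expR (- (complex.Re s * ln (r.+1 ^ m)%:R)))); last first.
  by rewrite ler_wpM2r ?expR_ge0 // -natrX ler_nat ha.
(* In exponential form the claim is -ln (r + 1) <= (D - m Re s) ln (r + 1), which is where [hs]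
   enters. *)
rewrite natrX lnXn // -[in leLHS](lnK r_gt0) -[X in X ^+ D](lnK r_gt0).
rewrite -expRN -expRM_natl -expRD ler_expR.
have ln_ge0 : 0 <= ln r.+1%:R :> R by rewrite ln_ge0 // ler1n.
rewrite -[_ *+ m]mulr_natl -subr_ge0 (_ : _ - _ =
  (D%:R + 1 - m%:R * complex.Re s) * ln r.+1%:R); last by ring.
by rewrite mulr_ge0 // subr_ge0.
Qed.

(* All the terms under the maximum are positive, so its initial value 0 is
   harmless. *)
Theorem corollary2p7 (R : realType) (n : nat) (hn : (1 < n)%N) (s : R[i])
    (hs : complex.Re s <=
      \big[Num.max/0]_(d < n)
        (d%:R * (n%:R - 1 - d%:R) / (n%:R - 1 + d%:R)
         + 1 / (n%:R - 1 + d%:R))) :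
  ~ cvgn (subring_zeta n s : nat -> R[i]^o).
Proof.
case: n hn hs => [|n] // n_gt0 hs.
(* From here on [n] is one less than the n of the statement. *)
have n1 : n.+1%:R - 1 = n%:R :> R by rewrite -natr1 addrK.
have [d hd] : exists d : 'I_n.+1,
    complex.Re s <= d%:R * (n%:R - d%:R) / (n%:R + d%:R) + 1 / (n%:R + d%:R).
  apply: contrapT => /forallNP small.
  move: hs; apply/negP; rewrite -ltNge.
  have lt_s (d : 'I_n.+1) :
      d%:R * (n%:R - d%:R) / (n%:R + d%:R) + 1 / (n%:R + d%:R)
      < complex.Re s by rewrite ltNge; apply/negP; apply: small.
  (* The initial value 0 is also below Re s, since the term at d = 0 is 1/n >= 0. *)
  apply: bigmax_lt => [|d _]; last by rewrite n1.
  apply: le_lt_trans (lt_s ord0).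
  by rewrite /= !mul0r add0r addr0 divr_ge0.
have dn : (d <= n)%N by rewrite -ltnS.
apply: (@dirichlet_series_dvg _ _ (n + d) (d * (n - d))).
- by rewrite addn_gt0 -ltnS n_gt0.
- by move=> r r_gt0; apply: nb_subrings_ge.
have nd_gt0 : 0 < n%:R + d%:R :> R by rewrite -natrD ltr0n; lia.
by rewrite natrD natrM natrB // mulrC -ler_pdivlMr // mulrDl.
Qed.
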